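(* Let $d \ge 1$ be an integer and let $T, S, D > 0$ be real numbers such that the maximum $B_3^+(T,S,D)$ is achieved by some $\lambda^* \in \mathcal{F}_3(T,S;D)$. Then $$B_3^+(T, S, D) = \max\bigl\{ \Lambda : (\Lambda, a, b, j) \in \mathbb{R}_{>0}^3 \times \{0, \ldots, d-1\} \text{ satisfies } (\star_j) \bigr\},$$ where $(\star_j)$ is the system $$\begin{cases} \Lambda + j a + (d - 1 - j) b = T,\\ \Lambda^2 + j a^2 + (d - 1 - j) b^2 = S,\\ \Lambda \cdot a^j \cdot b^{d - 1 - j} = D. \end{cases}$$
   Context: $\mathcal{F}_3(T,S;D) := \{\lambda \in \mathbb{R}^d_{>0} : \sum_{i=1}^d \lambda_i = T,\ \sum_{i=1}^d \lambda_i^2 = S,\ \prod_{i=1}^d \lambda_i = D\}$ and $B_3^+(T,S,D) := \max\{\lambda_1 : \lambda \in \mathcal{F}_3(T,S;D)\}$. *)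

(* Defs.v *)
From mathcomp Require Import all_boot all_order all_algebra.
From mathcomp Require Import all_classical all_reals.

Set Implicit Arguments.
Unset Strict Implicit.
Unset Printing Implicit Defensive.

Import Order.TTheory GRing.Theory Num.Theory.
Local Open Scope classical_set_scope.
Local Open Scope ring_scope.

Definition is_max (R : realType) (A : set R) (m : R) : Prop :=
  A m /\ ubound A m.

(* The value is 0 when A has no greatest element. *)
Definition maxset (R : realType) (A : set R) : R :=
  xget 0 [set m | is_max A m].

Definition F3 (R : realType) (d : nat) (T S D : R) : set 'rV[R]_d :=
  [set lam | [/\ forall i, 0 < lam 0 i,
                 \sum_(i < d) lam 0 i = T,
                 \sum_(i < d) lam 0 i ^+ 2 = S
               & \prod_(i < d) lam 0 i = D]].
Arguments F3 {R} d T S D _.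

(* The coordinates are numbered from 0, so this is lambda_1. *)
Definition coord1 (R : realType) (d : nat) (hd : (1 <= d)%N)
    (lam : 'rV[R]_d) : R :=
  lam 0 (Ordinal hd).

Definition B3plus (R : realType) (d : nat) (hd : (1 <= d)%N) (T S D : R) : R :=
  maxset [set coord1 hd lam | lam in F3 d T S D].

Definition star (R : realType) (d : nat) (T S D : R)
    (L a b : R) (j : nat) : Prop :=
  [/\ L + j%:R * a + (d - 1 - j)%:R * b = T,
      L ^+ 2 + j%:R * a ^+ 2 + (d - 1 - j)%:R * b ^+ 2 = S
    & L * a ^+ j * b ^+ (d - 1 - j) = D].

(* Main.v *)
Require Import Defs.
From mathcomp Require Import all_boot all_order all_algebra perm.
From mathcomp Require Import all_classical all_reals.
From mathcomp Require Import polyrcf ring lra.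

Set Implicit Arguments.
Unset Strict Implicit.
Unset Printing Implicit Defensive.

Import Order.TTheory GRing.Theory Num.Theory.
Local Open Scope classical_set_scope.
Local Open Scope ring_scope.

(** Replace four coordinates [x <= y < z <= w] of a feasible point by the roots
    of [(t - x)(t - y)(t - z)(t - w) - c t]: for [c > 0] small this quartic has
    four simple positive roots, one of them larger than [w], and since only the
    coefficient of [t] has changed, the roots have the same sum, the same sum
    of squares and the same product.  If [w] is the largest first coordinate of
    a feasible point then, by symmetry, no coordinate exceeds it, so no such
    [x], [y], [z] occur among the other coordinates of a maximizer: apart from
    one smallest coordinate, these are all equal.  In particular they take at
    most two values. *)

Lemma maxset_unique (R : realType) (A : set R) (m : R) :
  is_max A m -> Defs.maxset A = m.
Proof.
move=> Am; apply: xget_unique => // m' [Am' ubm'].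
by apply/eqP; rewrite eq_le Am.2 // ubm' //; case: Am.
Qed.

Lemma coef_prod_XsubC_cons (R : comNzRingType) (x : R) (s : seq R) (k : nat) :
  (\prod_(y <- x :: s) ('X - y%:P))`_k.+1 =
  (\prod_(y <- s) ('X - y%:P))`_k - x * (\prod_(y <- s) ('X - y%:P))`_k.+1.
Proof. by rewrite big_cons mulrBl coefB coefXM coefCM. Qed.

Lemma sum_sqr_coef_prod_XsubC (R : comNzRingType) (s : seq R) :
  (1 < size s)%N ->
  let p := \prod_(x <- s) ('X - x%:P) in
  \sum_(x <- s) x ^+ 2 = p`_(size s).-1 ^+ 2 - p`_(size s).-2 *+ 2.
Proof.
move=> s_gt1 /=; rewrite coefPn_prod_XsubC; last by case: s s_gt1.
case: s s_gt1 => // x [//|y s] _ /=; elim: s x y => [|z s IHs] x y.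
  by rewrite coef0_prod_XsubC /= !big_cons !big_nil; ring.
have IH := IHs y z.
rewrite big_cons IH coef_prod_XsubC_cons.
rewrite (coefPn_prod_XsubC (ps := [:: y, z & s])) //= (big_cons _ _ x); ring.
Qed.

Definition same_sum_sqr_prod (R : pzSemiRingType) (s t : seq R) : Prop :=
  [/\ size s = size t, \sum_(x <- s) x = \sum_(x <- t) x,
      \sum_(x <- s) x ^+ 2 = \sum_(x <- t) x ^+ 2
    & \prod_(x <- s) x = \prod_(x <- t) x].

Lemma same_sum_sqr_prod_coef (R : comNzRingType) (s t : seq R) :
  let p := \prod_(x <- s) ('X - x%:P) in
  let q := \prod_(x <- t) ('X - x%:P) in
  size s = size t -> (1 < size s)%N ->
  p`_(size s).-1 = q`_(size s).-1 -> p`_(size s).-2 = q`_(size s).-2 ->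
  p`_0 = q`_0 -> same_sum_sqr_prod s t.
Proof.
move=> p q st s_gt1 pq1 pq2 pq0.
have s_neq0 : size s != 0%N by rewrite -lt0n ltnW.
split=> //.
- by apply: oppr_inj; rewrite -!coefPn_prod_XsubC -?st.
- by rewrite !sum_sqr_coef_prod_XsubC -?st // pq1 pq2.
- apply: (can_inj (signrMK (size s))).
  by rewrite -coef0_prod_XsubC pq0 st coef0_prod_XsubC.
Qed.

Definition sign_change (R : realDomainType) (p : {poly R}) : rel R :=
  fun u v => (u < v) && (p.[u] * p.[v] < 0).

Lemma roots_of_sign_changes (R : rcfType) (p : {poly R}) (u : R) (s : seq R) :
  path (sign_change p) u s ->
  exists rs, [/\ size rs = size s, path <%R u rs & all (root p) rs].
Proof.
elim: s u => [|v s IHs] u /=; first by exists [::].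
move=> /andP[/andP[uv puv] /IHs[rs [size_rs v_rs root_rs]]].
have [r + root_r] := poly_ivtoo (ltW uv) puv.
rewrite in_itv /= => /andP[ur rv]; exists (r :: rs) => /=.
by rewrite size_rs ur root_r root_rs (path_le lt_trans rv v_rs).
Qed.

Lemma monic_split_of_sign_changes (R : rcfType) (p : {poly R}) (u : R)
    (s : seq R) :
  p \is monic -> size p = (size s).+1 -> path (sign_change p) u s ->
  exists2 rs, path <%R u rs & p = \prod_(r <- rs) ('X - r%:P).
Proof.
move=> /monicP p_monic size_p /roots_of_sign_changes[rs [size_rs u_rs root_rs]].
exists rs => //; rewrite [LHS](all_roots_prod_XsubC _ root_rs).
- by rewrite p_monic scale1r.
- by rewrite size_p size_rs.
- by rewrite uniq_rootsE; apply/lt_sorted_uniq/path_sorted/u_rs.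
Qed.

Lemma monic_eventually_gt0 (R : rcfType) (p : {poly R}) (u : R) :
  p \is monic -> exists2 v, u < v & 0 < p.[v].
Proof.
move=> /monicP p_monic; have [|n pn] := @poly_pinfty_gt_lc _ p.
  by rewrite p_monic.
exists (Num.max n (u + 1)); first by rewrite lt_max ltrDl ltr01 orbT.
by rewrite (lt_le_trans _ (pn _ _)) ?p_monic // le_max lexx.
Qed.

Lemma has_gt_of_horner_prod_XsubC_lt0 (R : realDomainType) (s : seq R) (u : R) :
  (\prod_(x <- s) ('X - x%:P)).[u] < 0 -> has (> u) s.
Proof.
apply: contraTT => /hasPn s_le; rewrite -leNgt horner_prod big_seq.
apply: prodr_ge0 => x /s_le; rewrite -leNgt !hornerE; lra.
Qed.

Lemma size_monic_subZX (R : nzRingType) (p : {poly R}) (c : R) :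
  p \is monic -> (2 < size p)%N ->
  size (p - c *: 'X) = size p /\ p - c *: 'X \is monic.
Proof.
move=> /monicP p_monic p_gt2; have cX_lt : (size (- (c *: 'X)) < size p)%N.
  by rewrite size_polyN (leq_ltn_trans (size_scale_leq _ _)) ?size_polyX.
by rewrite monicE size_polyDl // lead_coefDl // p_monic.
Qed.

Lemma quartic_subZX_sign_changes (R : rcfType) (x y z w : R) :
  0 < x -> x <= y -> y < z -> z <= w ->
  exists c : R, let q := \prod_(r <- [:: x; y; z; w]) ('X - r%:P) - c *: 'X in
    q.[w] < 0 /\ exists2 s, size s = 4%N & path (sign_change q) 0 s.
Proof.
move=> x_gt0 xy yz zw; set p := \prod_(r <- _) _.
have pE t : p.[t] = (t - x) * (t - y) * (t - z) * (t - w).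
  by rewrite horner_prod !big_cons big_nil !hornerXsubC mulr1 !mulrA.
(* The signs at [0], [y], [m], [w] are [+ - + -]: [p] vanishes at [y] and [w],
   and the choice of [c] halves its positive value at [m]. *)
pose m := (y + z) / 2; pose c := p.[m] / (2 * m); exists c => q.
have qE t : q.[t] = p.[t] - c * t by rewrite !hornerE.
have m_gt0 : 0 < m by rewrite /m; lra.
have pm_gt0 : 0 < p.[m].
  have -> : p.[m] = (m - x) * (m - y) * ((z - m) * (w - m)) by rewrite pE; ring.
  by rewrite !mulr_gt0 // /m; lra.
have c_gt0 : 0 < c by rewrite divr_gt0 // mulr_gt0.
have q0_gt0 : 0 < q.[0].
  have -> : q.[0] = x * y * z * w by rewrite qE pE; ring.
  by rewrite !mulr_gt0 //; lra.
have qy_lt0 : q.[y] < 0.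
  by rewrite qE pE subrr mulr0 !mul0r sub0r oppr_lt0 mulr_gt0 //; lra.
have qm_gt0 : 0 < q.[m].
  have -> : q.[m] = p.[m] / 2 by rewrite qE /c; field; exact: lt0r_neq0.
  by rewrite divr_gt0.
have qw_lt0 : q.[w] < 0.
  by rewrite qE pE subrr mulr0 sub0r oppr_lt0 mulr_gt0 //; lra.
have [M wM qM_gt0] : exists2 v, w < v & 0 < q.[v].
  apply: monic_eventually_gt0; apply: (size_monic_subZX _ _ _).2.
    exact: monic_prod_XsubC.
  by rewrite size_prod_XsubC.
split=> //; exists [:: y; m; w; M] => //=; rewrite /sign_change wM.
rewrite pmulr_rlt0 // nmulr_rlt0 // pmulr_rlt0 // nmulr_rlt0 //.
by rewrite qy_lt0 qm_gt0 qw_lt0 qM_gt0 !andbT /m; lra.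
Qed.

Lemma exists_same_sum_sqr_prod_gt (R : rcfType) (x y z w : R) :
  0 < x -> x <= y -> y < z -> z <= w ->
  exists v : seq R, [/\ all (> 0) v, has (> w) v
                      & same_sum_sqr_prod v [:: x; y; z; w]].
Proof.
move=> x_gt0 xy yz zw.
have [c] := quartic_subZX_sign_changes x_gt0 xy yz zw.
set p := \prod_(r <- _) _; set q := p - _ => /= -[qw_lt0 [s size_s q_signs]].
have size_p : size p = 5%N by rewrite size_prod_XsubC.
have [size_q q_monic] : size q = 5%N /\ q \is monic.
  rewrite -size_p; apply: size_monic_subZX; last by rewrite size_p.
  exact: monic_prod_XsubC.
have [|v v_gt0 q_split] := monic_split_of_sign_changes q_monic _ q_signs.
  by rewrite size_q size_s.
have size_v : size v = 4%N.
  by apply: succn_inj; rewrite -size_q q_split size_prod_XsubC.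
have coef_q k : k != 1%N -> q`_k = p`_k.
  by rewrite coefB coefZ coefX => /negbTE ->; rewrite mulr0 subr0.
exists v; split; first exact: lt_path_min.
  by apply: has_gt_of_horner_prod_XsubC_lt0; rewrite -q_split.
by apply: same_sum_sqr_prod_coef; rewrite ?size_v -?q_split ?coef_q.
Qed.

Lemma constant_off_argmin (d : Order.disp_t) (T : orderType d) (I : finType)
    (f : I -> T) (i0 : I) :
  (forall i j k, i != j -> (f i <= f j)%O -> (f k <= f j)%O) ->
  exists i j, forall k, k != i -> f k = f j.
Proof.
move=> f_le_above.
have [i _ f_min] := @arg_minP _ _ _ i0 xpredT f isT.
have [j _ f_max] := @arg_maxP _ _ _ i0 xpredT f isT.
exists i, j => k ki; apply: le_anti; apply/andP; split; first exact: f_max.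
by apply: (f_le_above i); [rewrite eq_sym | exact: f_min].
Qed.

Lemma card_ltn_ord (n j : nat) :
  (j <= n)%N -> #|[set i : 'I_n | (i < j)%N]%SET| = j.
Proof.
move=> jn; rewrite -sum1dep_card -(big_ord_widen n (fun=> 1%N)) //.
by rewrite sum1_card card_ord.
Qed.

Lemma big_if_const (T : Type) (idx : T) (op : Monoid.com_law idx) (I : finType)
    (A : {set I}) (a b : T) :
  \big[op/idx]_i (if i \in A then a else b) =
  op (iter #|A| (op a) idx) (iter #|~: A| (op b) idx).
Proof.
rewrite big_if big_const; congr (op _ _).
by rewrite -big_const; apply: eq_bigl => i; rewrite inE.
Qed.

Definition two_valued_row (R : Type) (n : nat) (L a b : R) (A : {set 'I_n}) :
    'rV[R]_n.+1 :=
  \row_i if unlift ord0 i is Some k then if k \in A then a else b else L.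

Lemma big_two_valued_row (R T : Type) (idx : T) (op : Monoid.com_law idx)
    (F : R -> T) (n : nat) (L a b : R) (A : {set 'I_n}) :
  \big[op/idx]_i F (two_valued_row L a b A 0 i) =
  op (F L) (op (iter #|A| (op (F a)) idx) (iter (n - #|A|) (op (F b)) idx)).
Proof.
rewrite big_ord_recl mxE unlift_none; congr (op _ _).
have <- : #|~: A| = (n - #|A|)%N by rewrite cardsCs finset.setCK card_ord.
by rewrite -big_if_const; apply: eq_bigr => i _; rewrite mxE liftK (fun_if F).
Qed.

Definition update_row (R : Type) (n : nat) (lam : 'rV[R]_n) (s : seq 'I_n)
    (v : seq R) : 'rV[R]_n :=
  \row_i nth (lam 0 i) v (index i s).

Lemma map_update_row (R : Type) (n : nat) (lam : 'rV[R]_n) (s : seq 'I_n)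
    (v : seq R) :
  uniq s -> size v = size s -> [seq update_row lam s v 0 i | i <- s] = v.
Proof.
move=> s_uniq size_v; case: s s_uniq size_v => [|i s] s_uniq size_v.
  by rewrite [RHS]size0nil.
apply: (@eq_from_nth _ (lam 0 i)); rewrite size_map // => k k_lt.
rewrite (nth_map i) // mxE index_uniq //.
by apply: set_nth_default; rewrite size_v.
Qed.

Lemma big_update_row (R T : Type) (idx : T) (op : Monoid.com_law idx)
    (F : R -> T) (n : nat) (lam : 'rV[R]_n) (s : seq 'I_n) (v : seq R) :
  uniq s -> size v = size s ->
  \big[op/idx]_(x <- v) F x = \big[op/idx]_(x <- [seq lam 0 i | i <- s]) F x ->
  \big[op/idx]_i F (update_row lam s v 0 i) = \big[op/idx]_i F (lam 0 i).
Proof.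
move=> s_uniq size_v eq_on_s; rewrite (bigID [in s]) [RHS](bigID [in s]) /=.
congr (op _ _); last first.
  apply: eq_bigr => i i_notin; rewrite mxE nth_default // size_v.
  by rewrite (memNindex i_notin).
rewrite -!big_uniq // -[RHS](big_map (lam 0) xpredT) -eq_on_s.
by rewrite -[in RHS](map_update_row lam s_uniq size_v) big_map.
Qed.

Section FeasibleSet.

Variable R : realType.
Implicit Types (n : nat) (T S D : R).

Lemma F3_two_valued_row n T S D (L a b : R) (A : {set 'I_n}) :
  0 < L -> 0 < a -> 0 < b ->
  F3 n.+1 T S D (two_valued_row L a b A) <-> star n.+1 T S D L a b #|A|.
Proof.
move=> L_gt0 a_gt0 b_gt0.
have row_gt0 i : 0 < two_valued_row L a b A 0 i.
  by rewrite mxE; case: unliftP => // k _; case: ifP.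
rewrite /F3 /star /= (big_two_valued_row _ id).
rewrite (big_two_valued_row _ (fun x => x ^+ 2)) (big_two_valued_row _ id) /=.
rewrite !iter_addr_0 !iter_mulr_1 subn1 /= !mulr_natl !addrA mulrA.
by split=> [[_]|[]].
Qed.

Lemma F3_col_perm n T S D (lam : 'rV[R]_n) (s : 'S_n) :
  F3 n T S D lam -> F3 n T S D (col_perm s lam).
Proof.
move=> [lam_gt0 <- <- <-]; split=> [i|||]; rewrite ?mxE //.
all: rewrite [RHS](reindex_inj (@perm_inj _ s)).
all: by apply: eq_bigr => i _; rewrite mxE.
Qed.

Lemma F3_coord_le n T S D (i : 'I_n) (L : R) :
  (forall lam, F3 n T S D lam -> lam 0 i <= L) ->
  forall lam j, F3 n T S D lam -> lam 0 j <= L.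
Proof.
move=> coord_i_le lam j lamF.
by have := coord_i_le _ (F3_col_perm (tperm i j) lamF); rewrite mxE tpermL.
Qed.

Lemma F3_update_row n T S D (lam : 'rV[R]_n) (s : seq 'I_n) (v : seq R) :
  uniq s -> all (> 0) v -> same_sum_sqr_prod v [seq lam 0 i | i <- s] ->
  F3 n T S D lam -> F3 n T S D (update_row lam s v).
Proof.
move=> s_uniq /allP v_gt0 [+ v_sum v_sqr v_prod] [lam_gt0 <- <- <-].
rewrite size_map => size_v; split; last 3 first.
- exact: (big_update_row (F := id)).
- exact: (big_update_row (F := fun x => x ^+ 2)).
- exact: (big_update_row (F := id)).
move=> i; rewrite mxE; case: (ltnP (index i s) (size v)) => [iv|vi].
  exact/v_gt0/mem_nth.
by rewrite nth_default.
Qed.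

Section Maximizer.

Variables (n : nat) (T S D : R) (lam : 'rV[R]_n.+1).
Hypothesis lamF : F3 n.+1 T S D lam.
Hypothesis lam_max : forall mu, F3 n.+1 T S D mu -> mu 0 ord0 <= lam 0 ord0.

Lemma maximizer_le_above (i j k : 'I_n) :
  i != j -> lam 0 (lift ord0 i) <= lam 0 (lift ord0 j) ->
  lam 0 (lift ord0 k) <= lam 0 (lift ord0 j).
Proof.
move=> ij lam_ij; rewrite leNgt; apply/negP => lam_jk.
have coord_le := F3_coord_le lam_max.
have [lam_gt0 _ _ _] := lamF.
have [v [v_gt0 v_has v_same]] :=
  exists_same_sum_sqr_prod_gt (lam_gt0 _) lam_ij lam_jk (coord_le _ _ lamF).
pose s := [:: lift ord0 i; lift ord0 j; lift ord0 k; ord0].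
have s_uniq : uniq s.
  have jk : j != k by apply: contraTneq lam_jk => ->; rewrite ltxx.
  have ik : i != k by apply: contraTneq lam_jk => <-; rewrite -leNgt.
  by rewrite /= !inE !(inj_eq lift_inj) !negb_or ij ik jk.
have muF := F3_update_row s_uniq v_gt0 v_same lamF.
have [x x_v lam_lt_x] := hasP v_has.
have: x \in [seq update_row lam s v 0 i | i <- s].
  by rewrite map_update_row //; case: v_same.
by case/mapP=> l _ x_l; have := coord_le _ l muF; rewrite -x_l leNgt lam_lt_x.
Qed.

Lemma maximizer_two_valued :
  exists a b (A : {set 'I_n}),
    [/\ 0 < a, 0 < b & lam = two_valued_row (lam 0 ord0) a b A].
Proof.
have [lam_gt0 _ _ _] := lamF.
suff [a [b [A [a_gt0 b_gt0 lam_A]]]] : exists a b (A : {set 'I_n}),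
    [/\ 0 < a, 0 < b
      & forall k, lam 0 (lift ord0 k) = if k \in A then a else b].
  exists a, b, A; split=> //; apply/rowP => i; rewrite mxE.
  by case: unliftP => [k|] ->.
have [i0 _|no_coord] := pickP 'I_n.
  have [i [j lam_off_i]] := constant_off_argmin i0 maximizer_le_above.
  exists (lam 0 (lift ord0 i)), (lam 0 (lift ord0 j)), [set i]%SET.
  split=> // k.
  by rewrite inE; case: eqVneq => [->|/lam_off_i].
by exists 1, 1, finset.set0; split=> // k; have := no_coord k.
Qed.

End Maximizer.

End FeasibleSet.

Theorem theorem4p2 (R : realType) (d : nat) (hd : (1 <= d)%N) (T S D : R)
  (hT : 0 < T) (hS : 0 < S) (hD : 0 < D)
  (hmax : exists2 lamstar : 'rV[R]_d, F3 d T S D lamstar &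
     is_max [set coord1 hd lam | lam in F3 d T S D] (coord1 hd lamstar)) :
  is_max
    [set L : R | exists (a b : R) (j : 'I_d),
       [/\ 0 < L, 0 < a, 0 < b & star d T S D L a b j]]
    (B3plus hd T S D).
Proof.
case: hmax => lam lamF lamM; rewrite /B3plus (maxset_unique lamM).
case: d hd lam lamF lamM => // n hd lam lamF [_ lam_ub].
have coord1E mu : coord1 hd mu = mu 0 ord0 by congr (mu 0 _); apply: val_inj.
have lam_max mu : F3 n.+1 T S D mu -> mu 0 ord0 <= lam 0 ord0.
  by move=> muF; rewrite -!coord1E; apply: lam_ub; exists mu.
have [lam_gt0 _ _ _] := lamF; rewrite coord1E; split=> /=.
- have [a [b [A [a_gt0 b_gt0 lamE]]]] := maximizer_two_valued lamF lam_max.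
  have A_lt : (#|A| < n.+1)%N by rewrite ltnS -[leqRHS]card_ord max_card.
  exists a, b, (Ordinal A_lt); split=> //=.
  by apply/F3_two_valued_row; rewrite // -lamE.
- move=> L [a [b [j [L_gt0 a_gt0 b_gt0 Lab_star]]]].
  pose A := [set i : 'I_n | (i < j)%N]%SET.
  have := lam_max (two_valued_row L a b A).
  rewrite mxE unlift_none; apply; apply/F3_two_valued_row => //.
  by rewrite card_ltn_ord // -ltnS.
Qed.
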